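(* Assume $S\times M\neq\emptyset$, let $(x,\lambda):[t_0,+\infty[\ \to X\times Y$ be a solution of (AHT), and suppose that $\varepsilon\notin\mathcal{L}^1([t_0,+\infty[)$ and that either $\dot\varepsilon\in\mathcal{L}^1([t_0,+\infty[)$ or $|\dot\varepsilon|^2/\varepsilon\in\mathcal{L}^1([t_0,+\infty[)$. Then for every $(\bar x,\bar\lambda)\in S\times M$, \[ \lim_{t\to+\infty}\big(L(x(t),\bar\lambda)-L(\bar x,\lambda(t))\big)=0\quad\text{and}\quad\lim_{t\to+\infty}\|(\dot x(t),\dot\lambda(t))\|=0. \]
   Context: $X,Y$ are real Hilbert spaces; $X\times Y$ carries the product inner product and norm $\|\cdot\|$. Standing assumptions: $f:X\to\mathbb{R}$ is convex and continuously differentiable with $\nabla f$ Lipschitz continuous on bounded subsets of $X$; $A:X\to Y$ is linear and continuous with adjoint $A^*$; $b\in Y$; $\varepsilon:[t_0,+\infty[\ \to\ ]0,+\infty[$ ($t_0\ge0$) is continuously differentiable with $\lim_{t\to+\infty}\varepsilon(t)=0$. $L(x,\lambda)=f(x)+\langle\lambda,Ax-b\rangle_Y$. $S$ is the set of optimal solutions of $\min\{f(x):Ax=b\}$, $M$ the set of Lagrange multipliers; $S\times M$ is the set of saddle points of $L$. (AHT) is the system $\dot x+\nabla f(x)+A^*\lambda+\varepsilon(t)x=0$, $\dot\lambda+b-Ax+\varepsilon(t)\lambda=0$; a solution is a continuously differentiable $(x,\lambda):[t_0,+\infty[\ \to X\times Y$ satisfying it on $[t_0,+\infty[$ (existence and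 uniqueness for every initial datum is assumed). *)

(* Defs.v *)
From HB Require Import structures.
From mathcomp Require Import all_boot all_order all_algebra.
From mathcomp Require Import all_classical all_reals all_analysis.
Set Implicit Arguments. Unset Strict Implicit. Unset Printing Implicit Defensive.
Import Order.TTheory GRing.Theory Num.Theory.
Import numFieldNormedType.Exports.
Local Open Scope classical_set_scope.
Local Open Scope ring_scope.

(* A real Hilbert space: a complete normed space whose norm comes from an
   inner product [ip] (symmetric, linear in the first argument, and
   ip u u = |u|^2). *)
Definition is_inner_product (R : realType) (V : completeNormedModType R)
  (ip : V -> V -> R) : Prop :=
  [/\ forall u v, ip u v = ip v u,
      forall a u v w, ip (a *: u + v) w = a * ip u w + ip v w
    & forall u, ip u u = `|u| ^+ 2].

Definition convex_fun (R : realType) (V : normedModType R) (f : V -> R) : Prop :=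
  forall (u v : V) (s : R), 0 <= s <= 1 ->
    f (s *: u + (1 - s) *: v) <= s * f u + (1 - s) * f v.

Definition lipschitz_on_bounded (R : realType) (V : normedModType R)
  (g : V -> V) : Prop :=
  forall r : R, exists K : R, forall u v : V,
    `|u| <= r -> `|v| <= r -> `|g u - g v| <= K * `|u - v|.

Definition lagrangian (R : realType) (X Y : normedModType R)
  (ipY : Y -> Y -> R) (f : X -> R) (A : X -> Y) (b : Y) (x : X) (lam : Y) : R :=
  f x + ipY lam (A x - b).

(* Saddle points of L; by the standing assumptions S x M is exactly this set. *)
Definition saddle_point (R : realType) (X Y : normedModType R)
  (L : X -> Y -> R) (xb : X) (lb : Y) : Prop :=
  forall (x : X) (lam : Y), L xb lam <= L xb lb /\ L xb lb <= L x lb.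

Definition prod_norm (R : realType) (X Y : normedModType R) (u : X) (v : Y) : R :=
  Num.sqrt (`|u| ^+ 2 + `|v| ^+ 2).

(* Main.v *)
Require Import Defs.
From HB Require Import structures.
From mathcomp Require Import all_boot all_order all_algebra.
From mathcomp Require Import all_classical all_reals all_analysis.
From mathcomp Require Import measurable_realfun ring lra.
Import Order.TTheory GRing.Theory Num.Theory.
Import numFieldNormedType.Exports.
Local Open Scope classical_set_scope.
Local Open Scope ring_scope.

(* Write z = (x, lam) and let T be the monotone operator
   (x, lam) |-> (gradf x + Astar lam, b - A x), so that z' + T z + eps z = 0.
   Testing the equation against z - zb and using the saddle inequality gives
   0 <= gap <= - <z' + eps z, z - zb>; hence z is bounded, and everything
   reduces to z' -> 0.  For fixed h > 0, monotonicity of T yields, for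
   phi t = |z (t + h) - z t|^2, an inequality
   phi' <= - eps (t + h) phi + k with k >= 0 the derivative of a bounded function
   (this is where the hypotheses on eps' enter); since the primitive of eps is
   unbounded, phi -> 0.  Finally T is Lipschitz on the bounded trajectory, so
   z' varies by O(h) + o(1) on [t, t + h], and letting h be small gives z' -> 0.
   Working with increments avoids differentiating the equation, whose solution
   need not be twice differentiable. *)

(** * Inner products: bilinearity, Cauchy-Schwarz, continuity and derivatives *)

Section InnerProduct.
Set Implicit Arguments. Unset Strict Implicit. Unset Printing Implicit Defensive.
Variables (R : realType) (V : completeNormedModType R) (ip : V -> V -> R).
Hypothesis ipP : is_inner_product ip.

Lemma ip_sym u v : ip u v = ip v u. Proof. by case: ipP. Qed.

Lemma ip_norm u : ip u u = `|u| ^+ 2. Proof. by case: ipP. Qed.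

Lemma ipDl u v w : ip (u + v) w = ip u w + ip v w.
Proof. by case: ipP => _ lin _; rewrite -{1}(scale1r u) lin mul1r. Qed.

Lemma ip0l w : ip 0 w = 0.
Proof. by apply: (addrI (ip 0 w)); rewrite -ipDl !addr0. Qed.

Lemma ipZl a u w : ip (a *: u) w = a * ip u w.
Proof. by case: ipP => _ lin _; rewrite -{1}(addr0 (a *: u)) lin ip0l addr0. Qed.

Lemma ipNl u w : ip (- u) w = - ip u w.
Proof. by rewrite -scaleN1r ipZl mulN1r. Qed.

Lemma ipBl u v w : ip (u - v) w = ip u w - ip v w.
Proof. by rewrite ipDl ipNl. Qed.

Lemma ipDr u v w : ip w (u + v) = ip w u + ip w v.
Proof. by rewrite ip_sym ipDl !(ip_sym w). Qed.

Lemma ipNr u w : ip w (- u) = - ip w u.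
Proof. by rewrite ip_sym ipNl ip_sym. Qed.

Lemma ipBr u v w : ip w (u - v) = ip w u - ip w v.
Proof. by rewrite ipDr ipNr. Qed.

Lemma ipZr a u w : ip w (a *: u) = a * ip w u.
Proof. by rewrite ip_sym ipZl ip_sym. Qed.

Lemma ip_polarization u v : ip u v = (`|u + v| ^+ 2 - `|u - v| ^+ 2) / 4.
Proof. by rewrite -!ip_norm !(ipDl, ipDr, ipNl, ipNr) (ip_sym v u); field. Qed.

Lemma ip_cauchy_schwarz u v : `|ip u v| <= `|u| * `|v|.
Proof.
wlog: u / 0 <= ip u v => [wl|uv0].
  have [/wl//|uv0] := leP 0 (ip u v).
  by have := wl (- u); rewrite ipNl normrN normrN; apply; rewrite oppr_ge0 ltW.
rewrite ger0_norm//.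
have [/eqP|v0] := boolP (v == 0).
  by move=> ->; rewrite ip_sym ip0l normr0 mulr0.
have [/eqP|u0] := boolP (u == 0).
  by move=> ->; rewrite ip0l normr0 mul0r.
have nu : 0 < `|u| by rewrite normr_gt0.
have nv : 0 < `|v| by rewrite normr_gt0.
(* This square expands to [2 * |u| * |v| * (|u| * |v| - ip u v)]; dividing by the positive product
   of norms gives the claim. *)
have := sqr_ge0 `|(`|v| *: u) - (`|u| *: v)|.
rewrite -ip_norm !(ipBl, ipBr, ipZl, ipZr) !ip_norm (ip_sym v u) => H.
rewrite -(ler_pM2l (mulr_gt0 nu nv)); nra.
Qed.

Lemma ip_le u v : ip u v <= `|u| * `|v|.
Proof. exact: le_trans (ler_norm _) (ip_cauchy_schwarz u v). Qed.

(** Polarization writes the pairing through norms of [u + v] and [u - v], so joint continuity is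
    inherited from the norm. *)
Lemma ip_cvg (T : Type) (F : set_system T) (FF : Filter F) (u v : T -> V) a b :
  u @ F --> a -> v @ F --> b -> (fun t => ip (u t) (v t)) @ F --> ip a b.
Proof.
move=> ua vb; under eq_fun do rewrite ip_polarization.
rewrite ip_polarization; apply: cvgMl; apply: cvgB; rewrite !expr2.
  by under eq_fun do rewrite expr2; apply: cvgM; apply: cvg_norm; exact: cvgD.
by under eq_fun do rewrite expr2; apply: cvgM; apply: cvg_norm; exact: cvgB.
Qed.

Lemma is_derive_ip (u v : R -> V) (t : R) du dv :
  is_derive t 1 u du -> is_derive t 1 v dv ->
  is_derive t 1 (fun s => ip (u s) (v s)) (ip du (v t) + ip (u t) dv).
Proof.
move=> u' v'.
suff H : (fun h => h^-1 *: (ip (u (h *: 1 + t)) (v (h *: 1 + t)) - ip (u t) (v t)))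
  @ 0^' --> ip du (v t) + ip (u t) dv.
  by apply: DeriveDef; [exact: cvgP H | exact: cvg_lim H].
have cvgd (w : R -> V) dw : is_derive t 1 w dw ->
    (fun h => h^-1 *: (w (h *: 1 + t) - w t)) @ 0^' --> dw.
  by move=> [wd <-]; exact: wd.
have cvgc (w : R -> V) dw : is_derive t 1 w dw ->
    (fun h => w (h *: 1 + t)) @ 0^' --> w t.
  have -> : (fun h : R => w (h *: 1 + t)) = (fun h => w (h + t)).
    by apply/funext => h; rewrite [_ *: _]mulr1.
  move=> [wd _]; have wc : {for t, continuous w}.
    by apply: differentiable_continuous; apply/derivable1_diffP.
  have ht : (fun h : R => h + t) @ 0^' --> t.
    rewrite -[X in _ --> X]add0r; apply: cvgD; last exact: cvg_cst.
    exact: cvg_within.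
  exact: cvg_comp ht wc.
rewrite [X in _ --> X]addrC.
have E : (fun h => h^-1 *: (ip (u (h *: 1 + t)) (v (h *: 1 + t)) - ip (u t) (v t))) =
   (fun h => ip (u (h *: 1 + t)) (h^-1 *: (v (h *: 1 + t) - v t)) +
    ip (h^-1 *: (u (h *: 1 + t) - u t)) (v t)).
  by apply/funext => h; rewrite ipZl ipZr ipBr ipBl /GRing.scale/=; ring.
rewrite E; apply: cvgD; apply: ip_cvg.
- exact: cvgc u'.
- exact: cvgd v'.
- exact: cvgd u'.
- exact: cvg_cst.
Qed.

Lemma is_derive_ip_self (u : R -> V) (t : R) du : is_derive t 1 u du ->
  is_derive t 1 (fun s => ip (u s) (u s)) (2 * ip du (u t)).
Proof.
move=> u'; apply: is_derive_eq (is_derive_ip u' u') _.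
by rewrite (ip_sym (u t)); ring.
Qed.

End InnerProduct.

(** * Calculus on a half-line: mean value estimates, primitives, integrability *)

Section Calculus.
Set Implicit Arguments. Unset Strict Implicit. Unset Printing Implicit Defensive.
Variable R : realType.
Implicit Types (t s h : R).

Lemma is_derive_continuous (V : normedModType R) (u : R -> V) t du :
  is_derive t 1 u du -> {for t, continuous u}.
Proof.
by move=> [ud _]; apply: differentiable_continuous; apply/derivable1_diffP.
Qed.

Lemma is_derive_translate (V : normedModType R) (u : R -> V) t h du :
  is_derive (t + h) 1 u du -> is_derive t 1 (fun s => u (s + h)) du.
Proof.
move=> [ud <-]; rewrite /derivable in ud.
have E : (fun k => k^-1 *: (u (k *: 1 + (t + h)) - u (t + h))) =
         (fun k => k^-1 *: (u (k *: 1 + t + h) - u (t + h))).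
  by apply/funext => k; rewrite addrA.
split; first by rewrite /derivable -E.
by rewrite /derive -E.
Qed.

Lemma is_derive_within_continuous (F dF : R -> R) t0 :
  (forall t, t0 <= t -> is_derive t 1 F (dF t)) ->
  {within `[t0, +oo[, continuous F}.
Proof.
move=> F'; apply: continuous_in_subspaceT => t; rewrite inE/= in_itv/= andbT => t0t.
exact: is_derive_continuous (F' t t0t).
Qed.

Lemma is_derive_mvt (F dF : R -> R) a b : a <= b ->
  (forall s, a <= s <= b -> is_derive s 1 F (dF s)) ->
  exists2 c, a <= c <= b & F b - F a = dF c * (b - a).
Proof.
move=> ab F'; have [||c cab E] := @MVT_segment R F dF a b ab.
- by move=> s; rewrite in_itv/= => /andP[/ltW as' /ltW sb]; apply: F'; rewrite as'.
- apply: continuous_in_subspaceT => s; rewrite inE/= in_itv/= => asb.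
  exact: is_derive_continuous (F' s asb).
- by exists c => //; rewrite in_itv/= in c ab cab.
Qed.

Lemma is_derive_nonincreasing (F dF : R -> R) t0 :
  (forall t, t0 <= t -> is_derive t 1 F (dF t)) ->
  (forall t, t0 <= t -> dF t <= 0) ->
  forall s t, t0 <= s -> s <= t -> F t <= F s.
Proof.
move=> F' F'0 s t t0s st; have [|c /andP[sc _] E] := @is_derive_mvt F dF _ _ st _.
  by move=> r /andP[sr _]; apply: F'; exact: le_trans sr.
rewrite -subr_le0 E mulr_le0_ge0 ?subr_ge0// F'0//; exact: le_trans sc.
Qed.

Lemma is_derive_nondecreasing (F dF : R -> R) t0 :
  (forall t, t0 <= t -> is_derive t 1 F (dF t)) ->
  (forall t, t0 <= t -> 0 <= dF t) ->
  forall s t, t0 <= s -> s <= t -> F s <= F t.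
Proof.
move=> F' F'0 s t t0s st; rewrite -lerN2.
apply: (@is_derive_nonincreasing (fun r => - F r) (fun r => - dF r) t0) => //.
- by move=> r t0r; have := F' _ t0r => ?; exact: is_deriveN.
- by move=> r t0r; rewrite oppr_le0 F'0.
Qed.

(** Vector-valued maps have no mean value equality, so the scalar theorem is applied to the pairing
    of [u s - s *: c] with the error vector [w] itself; Cauchy-Schwarz and division by the norm of
    [w] conclude. *)
Lemma norm_increment_le (V : completeNormedModType R) (ip : V -> V -> R)
    (u du : R -> V) (c : V) (B a b : R) :
  is_inner_product ip -> a <= b ->
  (forall s, a <= s <= b -> is_derive s 1 u (du s)) ->
  (forall s, a <= s <= b -> `|du s - c| <= B) ->
  `|u b - u a - (b - a) *: c| <= B * (b - a).
Proof.
move=> ipP ab u' du_le; set w := u b - u a - _.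
have [|r rab E] := @is_derive_mvt
    (fun s => ip (u s) w - s * ip c w) (fun s => ip (du s) w - ip c w) a b ab.
  move=> s sab; have u's := u' s sab.
  have H : is_derive s 1 (fun s => ip (u s) w) (ip (du s) w).
    have := is_derive_ip ipP u's (is_derive_cst w s 1).
    by rewrite (ip_sym ipP _ 0) (ip0l ipP) addr0.
  apply: is_deriveB.
  have := is_deriveM (is_derive_id s (1 : R)) (is_derive_cst (ip c w) s 1).
  by rewrite scaler0 add0r [_ *: _]mulr1.
have ww : `|w| ^+ 2 = ip (du r - c) w * (b - a).
  by rewrite (ipBl ipP) -E -(ip_norm ipP) {1}/w !(ipBl ipP) (ipZl ipP); ring.
have [->|w0] := eqVneq w 0.
  rewrite normr0 mulr_ge0 ?subr_ge0//; exact: le_trans (du_le r rab).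
have nw : 0 < `|w| by rewrite normr_gt0.
rewrite -(ler_pM2r nw) -expr2 ww -mulrA (mulrC _ `|w|) mulrA.
apply: ler_wpM2r; first by rewrite subr_ge0.
by apply: le_trans (ip_le ipP _ _) _; rewrite ler_wpM2r// du_le.
Qed.

Lemma exists_primitive (g : R -> R) t0 : continuous g ->
  exists G : R -> R, forall t, t0 <= t -> is_derive t 1 G (g t).
Proof.
(* Starting the integral at [t0 - 1] makes [t0] an interior point, so the derivative there is
   two-sided. *)
move=> cg; exists (fun t => \int[@lebesgue_measure R]_(s in `[t0 - 1, t]) g s)%R => t t0t.
have [] := @continuous_FTC1_closed R g (t0 - 1) t (t + 1).
- by rewrite ltrDl.
- apply: continuous_compact_integrable; first exact: segment_compact.
  exact: continuous_subspaceT.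
- lra.
- exact: cg.
- by move=> d e; split => //; rewrite -e derive1E.
Qed.

(** Freezing [g] at [g t0] to the left of [t0] extends it continuously to the whole line, where
    [exists_primitive] applies. *)
Lemma continuous_clamp (g : R -> R) t0 :
  {within `[t0, +oo[, continuous g} -> continuous (fun t => g (Num.max t t0)).
Proof.
move=> cg t; set m := Num.max t t0.
have mA : `[t0, +oo[%classic m by rewrite /= in_itv/= andbT le_max lexx orbT.
have gm : g @ within `[t0, +oo[%classic (nbhs m) --> g m.
  by rewrite (nbhs_subspace_in mA); exact: cg m.
apply: cvg_comp gm => P Pm.
have mc : {for t, continuous (fun s : R => Num.max s t0)}.
  by apply: (@continuous_max R R id (cst t0)); [exact: cvg_id | exact: cvg_cst].
have := mc _ Pm; apply: (@filterS _ (nbhs t)) => s /=; apply.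
by rewrite in_itv/= andbT le_max lexx orbT.
Qed.

Lemma exists_primitive_within (g : R -> R) t0 :
  {within `[t0, +oo[, continuous g} ->
  exists G : R -> R, forall t, t0 <= t -> is_derive t 1 G (g t).
Proof.
move=> /continuous_clamp /(@exists_primitive _ t0)[G G']; exists G => t t0t.
by have := G' t t0t; rewrite max_l.
Qed.

(** A bounded monotone primitive converges, and the improper fundamental theorem then gives a finite
    integral. Read contrapositively, it makes the primitive of a nonintegrable [eps] unbounded. *)
Lemma integrable_of_bounded_primitive (g G : R -> R) t0 B :
  {within `[t0, +oo[, continuous g} ->
  (forall t, t0 <= t -> 0 <= g t) ->
  (forall t, t0 <= t -> is_derive t 1 G (g t)) ->
  (forall t, t0 <= t -> G t <= B) ->
  (@lebesgue_measure R).-integrable `[t0, +oo[ (fun t => (g t)%:E).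
Proof.
move=> cg g0 G' GB.
have Gnd := is_derive_nondecreasing G' g0.
(* Clamping makes the primitive monotone on the whole line, as the monotone convergence theorem
   requires; it agrees with [G] eventually. *)
pose H t := G (Num.max t t0).
have Hnd : nondecreasing_fun H.
  move=> s t st; apply: Gnd; first by rewrite le_max lexx orbT.
  by rewrite ge_max !le_max lexx st !orbT.
have Hub : has_ubound (range H).
  by exists B => _ [t _ <-]; apply: GB; rewrite le_max lexx orbT.
have Hl := nondecreasing_cvgr Hnd Hub.
have Gl : G t @[t --> +oo] --> sup (range H).
  apply: cvg_trans Hl; apply: near_eq_cvg.
  by near=> t; rewrite /H max_l//; near: t; exact: nbhs_pinfty_ge.
have mg : measurable_fun `[t0, +oo[ g.
  by apply: subspace_continuous_measurable_fun => //.
apply/integrableP; split; first exact/measurable_EFinP.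
under eq_integral.
  by move=> t; rewrite inE/= in_itv/= andbT => t0t; rewrite /= ger0_norm ?g0//; over.
rewrite (@ge0_continuous_FTC2y R g G t0 (sup (range H)))//.
- by rewrite -EFinB ltry.
- by move=> t /ltW t0t; have [] := G' t t0t.
- by apply: cvg_at_right_filter; exact: is_derive_continuous (G' t0 (lexx _)).
- move=> t; rewrite in_itv/= andbT => /ltW t0t.
  by rewrite derive1E; have [] := G' t t0t.
Unshelve. all: by end_near. Qed.

(** The converse direction: [G t - G t0] is the integral over a segment, and positivity of [g]
    bounds it by the integral over the half-line. *)
Lemma primitive_bounded (g G : R -> R) t0 :
  {within `[t0, +oo[, continuous g} ->
  (forall t, t0 <= t -> 0 <= g t) ->
  (forall t, t0 <= t -> is_derive t 1 G (g t)) ->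
  (@lebesgue_measure R).-integrable `[t0, +oo[ (fun t => (g t)%:E) ->
  exists B, forall t, t0 <= t -> G t <= B.
Proof.
move=> cg g0 G' /integrableP[mg intg].
exists (G t0 + fine (\int[@lebesgue_measure R]_(s in `[t0, +oo[) `|(g s)%:E|)%E) => t t0t.
move: (t0t); rewrite le_eqVlt => /predU1P[<-|t0t'].
  by rewrite lerDl fine_ge0// integral_ge0.
rewrite -lerBlDl -lee_fin fineK; last first.
  by rewrite ge0_fin_numE// integral_ge0.
rewrite EFinB -(@continuous_FTC2 R g G t0 t t0t').
- under eq_integral.
    move=> s; rewrite inE/= in_itv/= => /andP[t0s _].
    rewrite -[(g s)%:E]gee0_abs ?lee_fin ?g0//; over.
  apply: ge0_subset_integral => //=.
  + apply/measurable_EFinP; apply: measurableT_comp => //; exact/measurable_EFinP.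
  + by move=> s /=; rewrite !in_itv/= andbT => /andP[].
- apply: continuous_subspaceW cg.
  by move=> s /=; rewrite !in_itv/= andbT => /andP[].
- split.
  + by move=> s; rewrite in_itv/= => /andP[/ltW t0s _]; have [] := G' s t0s.
  + by apply: cvg_at_right_filter; exact: is_derive_continuous (G' t0 (lexx _)).
  + by apply: cvg_at_left_filter; exact: is_derive_continuous (G' t t0t).
- move=> s; rewrite in_itv/= => /andP[/ltW t0s _].
  by rewrite derive1E; have [] := G' s t0s.
Qed.

End Calculus.

(** * A differential inequality with nonintegrable damping *)

Section ScalarEstimates.
Set Implicit Arguments. Unset Strict Implicit. Unset Printing Implicit Defensive.
Variable R : realType.
Implicit Types (t s h : R).

(** Since [K] is bounded, the source [k] can raise [phi] only slightly after a late time, while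
    damping with unbounded primitive [E] forces [phi] to become small at least once after that time.
    Together these keep [phi] small forever. *)
Lemma cvg_to0_of_derive_le (phi dphi K k E e : R -> R) t0 B :
  (forall t, t0 <= t -> is_derive t 1 phi (dphi t)) ->
  (forall t, t0 <= t -> is_derive t 1 K (k t)) ->
  (forall t, t0 <= t -> is_derive t 1 E (e t)) ->
  (forall t, t0 <= t -> 0 <= phi t) ->
  (forall t, t0 <= t -> 0 <= k t) ->
  (forall t, t0 <= t -> 0 <= e t) ->
  (forall t, t0 <= t -> dphi t <= - (e t * phi t) + k t) ->
  (forall t, t0 <= t -> K t <= B) ->
  (forall C, exists2 t, t0 <= t & C < E t) ->
  phi @ +oo --> 0.
Proof.
move=> phi' K' E' phi0 k0 e0 dphi_le KB Eub.
apply/cvgrPdist_le => d d0; have d2 : 0 < d / 2 by rewrite divr_gt0.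
have supK : has_sup [set K t | t in [set t | t0 <= t]].
  split; first by exists (K t0), t0 => //=.
  by exists B => _ [t t0t <-]; exact: KB.
have [_ [T /= t0T <-] KT] := sup_adherent d2 supK.
have Kle t : t0 <= t -> K t <= K T + d / 2.
  move=> t0t; rewrite -lerBlDr; apply: le_trans (ltW KT); rewrite lerB//.
  by apply: sup_upper_bound => //=; exists t.
(* If [phi] stayed above [d / 2] after [T], then [phi - K + d / 2 * E] would be nonincreasing, which
   would bound [E]. *)
have [s Ts phis] : exists2 s, T <= s & phi s <= d / 2.
  apply: contrapT => nex.
  have phi_gt s : T <= s -> d / 2 <= phi s.
    move=> Ts; rewrite leNgt; apply/negP => /ltW phis; apply: nex; by exists s.
  have FF : forall t, T <= t ->
      is_derive t 1 (fun t => phi t - K t + d / 2 * E t) (dphi t - k t + d / 2 * e t).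
    move=> t Tt; have t0t := le_trans t0T Tt.
    have := phi' t t0t; have := K' t t0t; have := E' t t0t => *.
    apply: is_deriveD.
  have Fle := is_derive_nonincreasing FF.
  have FT : forall t, T <= t -> phi t - K t + d / 2 * E t <= phi T - K T + d / 2 * E T.
    move=> t Tt; apply: Fle => // r Tr; have t0r := le_trans t0T Tr.
    have := dphi_le r t0r; have := ler_wpM2l (e0 r t0r) (phi_gt r Tr); lra.
  have Ebd t : T <= t -> E t <= (phi T - K T + d / 2 * E T + B) / (d / 2).
    move=> Tt; rewrite ler_pdivlMr//; have := FT t Tt.
    have := KB t (le_trans t0T Tt); have := phi0 t (le_trans t0T Tt); lra.
  have [t t0t] := Eub ((phi T - K T + d / 2 * E T + B) / (d / 2)).
  (* The time supplied by [Eub] may precede [T]; monotonicity of [E] covers that case. *)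
  have [Tt|tT] := leP T t; first by rewrite ltNge Ebd.
  rewrite ltNge (le_trans _ (Ebd T (lexx _)))//.
  exact: (is_derive_nondecreasing E' e0) (ltW tT).
(* Dropping the damping, [phi] gains after [s] at most the growth of [K], itself at most [d / 2] by
   the choice of [T]. *)
have phiK : forall t, s <= t -> phi t - K t <= phi s - K s.
  move=> t st; apply: (@is_derive_nonincreasing R (fun t => phi t - K t) (fun t => dphi t - k t) s) => // r sr;
    have t0r := le_trans (le_trans t0T Ts) sr.
  - by have := phi' r t0r; have := K' r t0r => *; exact: is_deriveB.
  - have := dphi_le r t0r; have := mulr_ge0 (e0 r t0r) (phi0 r t0r); lra.
near=> t.
have st : s <= t by near: t; apply: nbhs_pinfty_ge; exact: num_real.
have t0t := le_trans (le_trans t0T Ts) st.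
rewrite sub0r normrN ger0_norm ?phi0//.
have := phiK t st; have := Kle t t0t.
have := is_derive_nondecreasing K' k0 t0T Ts; lra.
Unshelve. all: by end_near. Qed.

End ScalarEstimates.

(** * Increments of [eps] under either integrability hypothesis *)

Section IncrementControl.
Set Implicit Arguments. Unset Strict Implicit. Unset Printing Implicit Defensive.
Variables (R : realType) (eps deps : R -> R) (t0 : R).
Hypothesis eps_gt0 : forall t, t0 <= t -> 0 < eps t.
Hypothesis eps' : forall t, t0 <= t -> is_derive t 1 eps (deps t).
Hypothesis cdeps : {within `[t0, +oo[, continuous deps}.

Lemma continuous_sqr_deps_div : {within `[t0, +oo[, continuous (fun t => deps t ^+ 2 / eps t)}.
Proof.
have ceps := is_derive_within_continuous eps'.
rewrite continuous_subspace_in => t; rewrite inE/= in_itv/= andbT => t0t.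
apply: cvgM; first by rewrite expr2; apply: cvgM; exact: cdeps.
by apply: cvgV; [rewrite gt_eqF ?eps_gt0 | exact: ceps].
Qed.

(** With [p] the square root of [eps], the density [deps ^+ 2 / eps] is four times the square of
    [p']. The bound is thus Cauchy-Schwarz for the integral of [p'] over [[t, t + h]], proved here
    by monotonicity of an auxiliary function. *)
Lemma sqrt_increment_le (G : R -> R) :
  (forall t, t0 <= t -> is_derive t 1 G (deps t ^+ 2 / eps t)) ->
  forall t h, t0 <= t -> 0 < h ->
  4 * (Num.sqrt (eps (t + h)) - Num.sqrt (eps t)) ^+ 2 <= h * (G (t + h) - G t).
Proof.
move=> G' t h t0t h0.
set p := fun s => Num.sqrt (eps s).
have p_gt0 s : t0 <= s -> 0 < p s by move=> t0s; rewrite sqrtr_gt0 eps_gt0.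
have pp s : t0 <= s -> p s ^+ 2 = eps s by move=> t0s; rewrite sqr_sqrtr ?ltW ?eps_gt0.
have p' s : t0 <= s -> is_derive s 1 p (deps s / (2 * p s)).
  move=> t0s; have := is_derive1_sqrt (eps_gt0 t0s); have := eps' t0s => e1 e2.
  have := is_derive1_comp e2 e1; rewrite mulrC; exact.
have tth : t <= t + h by rewrite lerDl ltW.
(* The sign [c] makes the increment positive, so that one may divide by it; a zero increment is
   treated apart. *)
suff key (c : R) : c = 1 \/ c = -1 -> 0 < c * (p (t + h) - p t) ->
    4 * (p (t + h) - p t) ^+ 2 <= h * (G (t + h) - G t).
  have [d0|d0|d0] := ltgtP (p (t + h) - p t) 0.
  - by apply: (key (-1)); [right | rewrite mulN1r oppr_gt0].
  - by apply: (key 1); [left | rewrite mul1r].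
  - rewrite -/(p _) -/(p t) d0 expr0n/= mulr0; apply: mulr_ge0; first exact: ltW.
    rewrite subr_ge0.
    apply: (is_derive_nondecreasing G') => // s t0s.
    by rewrite divr_ge0 ?sqr_ge0// ltW// eps_gt0.
move=> c1 d0; set d := c * _ in d0.
have dE : (p (t + h) - p t) ^+ 2 = d ^+ 2 by rewrite /d exprMn; case: c1 => ->; ring.
have cc : c ^+ 2 = 1 by case: c1 => ->; ring.
(* The weights make the derivative the perfect square [(h * p' - c * d) ^+ 2 / (h * d)], which
   vanishes when [p'] equals the mean slope of [p] over the step. *)
have F' s : t0 <= s -> is_derive s 1 (fun s => h / (4 * d) * G s + d / h * s - (2 * c) * p s)
    (h / (4 * d) * (deps s ^+ 2 / eps s) + d / h * 1 - 2 * c * (deps s / (2 * p s))).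
  move=> t0s; have Gs := G' s t0s; have ps := p' s t0s.
  have H1 : is_derive s 1 (fun s => h / (4 * d) * G s) (h / (4 * d) * (deps s ^+ 2 / eps s)).
    exact: is_deriveZ.
  have H2 : is_derive s 1 (fun s => d / h * s) (d / h * 1).
    by have := is_derive_id s (1 : R) => ?; exact: is_deriveZ.
  have H3 : is_derive s 1 (fun s => 2 * c * p s) (2 * c * (deps s / (2 * p s))).
    exact: is_deriveZ.
  exact: is_deriveB (is_deriveD H1 H2) H3.
have := is_derive_nondecreasing F' _ t0t tth.
have F0 s : t0 <= s ->
    0 <= h / (4 * d) * (deps s ^+ 2 / eps s) + d / h * 1 - 2 * c * (deps s / (2 * p s)).
  move=> t0s; have p0 := p_gt0 s t0s.
  have -> : h / (4 * d) * (deps s ^+ 2 / eps s) + d / h * 1 - 2 * c * (deps s / (2 * p s))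
     = (h * (deps s / (2 * p s)) - c * d) ^+ 2 / (h * d).
    rewrite -pp// sqrrB exprMn [(c * d) ^+ 2]exprMn cc; field.
    by rewrite !gt_eqF.
  by rewrite divr_ge0 ?sqr_ge0// ltW// mulr_gt0.
move=> /(_ F0) => H.
rewrite dE.
have {H} : 2 * d <= h / (4 * d) * (G (t + h) - G t) + d.
  have -> : h / (4 * d) * (G (t + h) - G t) + d =
     h / (4 * d) * (G (t + h) - G t) + d / h * (t + h - t) by field; rewrite !gt_eqF.
  have dd : d = c * (p (t + h) - p t) by [].
  move: H dd; clearbody d; lra.
rewrite -(ler_pM2r d0) => H.
have E : (h / (4 * d) * (G (t + h) - G t) + d) * d = h * (G (t + h) - G t) / 4 + d ^+ 2.
  by field; rewrite gt_eqF.
rewrite E in H; rewrite expr2; lra.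
Qed.

(** The cross term caused by the variation of [eps] is split into a part absorbed by the damping
    [eps (t + h) * a ^+ 2] and a part bounded by the increment of a bounded monotone [G]. *)
Lemma increment_control :
  (@lebesgue_measure R).-integrable `[t0, +oo[ (fun t => (deps t)%:E) \/
  (@lebesgue_measure R).-integrable `[t0, +oo[ (fun t => (deps t ^+ 2 / eps t)%:E) ->
  forall h M : R, 0 < h -> 0 <= M -> exists G g : R -> R, exists2 C : R, 0 <= C &
  [/\ forall t, t0 <= t -> 0 <= g t,
      forall t, t0 <= t -> is_derive t 1 G (g t), exists B, forall t, t0 <= t -> G t <= B &
      forall t a, t0 <= t -> 0 <= a -> a <= 2 * M ->
      2 * `|eps (t + h) - eps t| * M * a <= eps (t + h) * a ^+ 2 + C * (G (t + h) - G t)].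
Proof.
move=> [ideps|ig] h M h0 M0.
- pose g t := `|deps t|.
  have cg : {within `[t0, +oo[, continuous g}.
    by move=> t; apply: cvg_norm; exact: cdeps.
  have [G G'] := exists_primitive_within cg.
  have g0 t : t0 <= t -> 0 <= g t by rewrite normr_ge0.
  (* [4 * M ^+ 2] is the worst case of [2 * M * a], reached at [a = 2 * M]. *)
  exists G, g, (4 * M ^+ 2); first by rewrite mulr_ge0// sqr_ge0.
  split => //.
    by apply: (primitive_bounded cg g0 G'); have := integrable_norm ideps.
  move=> t a t0t a0 aM; have tth : t <= t + h by rewrite lerDl ltW.
  have e0 : 0 <= eps (t + h) * a ^+ 2.
    by rewrite mulr_ge0 ?sqr_ge0// ltW// eps_gt0// (le_trans t0t).
  suff D : `|eps (t + h) - eps t| <= G (t + h) - G t.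
    rewrite -[leLHS]add0r; apply: lerD => //.
    have : 2 * `|eps (t + h) - eps t| * M * a <= 2 * (G (t + h) - G t) * M * (2 * M).
      apply: ler_pM => //; first by rewrite !mulr_ge0.
      by rewrite ler_wpM2r// ler_wpM2l.
    by move=> /le_trans; apply; rewrite le_eqVlt; apply/orP; left; apply/eqP; ring.
  have P1 : forall s, t0 <= s -> is_derive s 1 (fun s => G s + eps s) (g s + deps s).
    by move=> s t0s; have := G' s t0s; have := eps' t0s => *; exact: is_deriveD.
  have P2 : forall s, t0 <= s -> is_derive s 1 (fun s => G s - eps s) (g s - deps s).
    by move=> s t0s; have := G' s t0s; have := eps' t0s => *; exact: is_deriveB.
  have := is_derive_nondecreasing P1 _ t0t tth.
  have := is_derive_nondecreasing P2 _ t0t tth.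
  move=> H2 H1.
  have {}H1 : G t + eps t <= G (t + h) + eps (t + h).
    apply: H1 => s _; have := ler_norm (- deps s); rewrite normrN /g; lra.
  have {}H2 : G t - eps t <= G (t + h) - eps (t + h).
    apply: H2 => s _; have := ler_norm (deps s); rewrite /g; lra.
  rewrite ler_norml; apply/andP; split; lra.
- have cg := continuous_sqr_deps_div.
  have [G G'] := exists_primitive_within cg.
  have g0 t : t0 <= t -> 0 <= deps t ^+ 2 / eps t.
    by move=> t0t; rewrite divr_ge0 ?sqr_ge0// ltW// eps_gt0.
  (* Two contributions [4 * M ^+ 2 * d ^+ 2] arise below, one from Young's inequality [S3] and one
     from the square in [D]; their sum is [2 * M ^+ 2] times the left side of [sqrt_increment_le],
     whence the factor [h]. *)
  exists G, (fun t => deps t ^+ 2 / eps t), (2 * M ^+ 2 * h).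
    by rewrite !mulr_ge0 ?sqr_ge0// ltW.
  split => //; first exact: (primitive_bounded cg g0 G').
  move=> t a t0t a0 aM; have := sqrt_increment_le G' t0t h0.
  have t0th : t0 <= t + h by rewrite (le_trans t0t)// lerDl ltW.
  set q := Num.sqrt (eps (t + h)); set p := Num.sqrt (eps t) => H.
  have <- : q ^+ 2 = eps (t + h) by rewrite sqr_sqrtr// ltW// eps_gt0.
  have <- : p ^+ 2 = eps t by rewrite sqr_sqrtr// ltW// eps_gt0.
  have p0 : 0 <= p by exact: sqrtr_ge0.
  have q0 : 0 <= q by exact: sqrtr_ge0.
  set d := `|q - p|.
  have d0 : 0 <= d by exact: normr_ge0.
  have dE : (q - p) ^+ 2 = d ^+ 2 by rewrite real_normK// num_real.
  have D : `|q ^+ 2 - p ^+ 2| <= 2 * q * d + d ^+ 2.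
    rewrite subr_sqr normrM -/d (ger0_norm (addr_ge0 q0 p0)).
    have : p - q <= d by rewrite /d distrC ler_norm.
    rewrite expr2; nra.
  rewrite dE in H.
  have S1 : 2 * `|q ^+ 2 - p ^+ 2| * M * a <= 2 * (2 * q * d + d ^+ 2) * M * a.
    by rewrite !ler_wpM2r// ler_wpM2l.
  apply: le_trans S1 _.
  have S2 : 2 * d ^+ 2 * M * a <= 2 * d ^+ 2 * M * (2 * M).
    by rewrite ler_wpM2l// !mulr_ge0// sqr_ge0.
  have S3 := sqr_ge0 (q * a - 2 * M * d).
  have S4 : 2 * M ^+ 2 * (4 * d ^+ 2) <= 2 * M ^+ 2 * (h * (G (t + h) - G t)).
    by rewrite ler_wpM2l// mulr_ge0// sqr_ge0.
  have S5 : 2 * (2 * q * d + d ^+ 2) * M * a = 2 * d ^+ 2 * M * a + 4 * q * d * M * a by ring.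
  rewrite S5.
  have S6 : (q * a - 2 * M * d) ^+ 2 = q ^+ 2 * a ^+ 2 - 4 * q * d * M * a + 4 * M ^+ 2 * d ^+ 2.
    by ring.
  have S7 : 2 * M ^+ 2 * (4 * d ^+ 2) = 4 * M ^+ 2 * d ^+ 2 + 2 * d ^+ 2 * M * (2 * M) by ring.
  have S8 : 2 * M ^+ 2 * h * (G (t + h) - G t) = 2 * M ^+ 2 * (h * (G (t + h) - G t)) by ring.
  rewrite S6 in S3; rewrite S7 in S4; rewrite S8; lra.
Qed.

(** A second primitive [H] of [G] turns the increment of [G] into the derivative of
    [H (t + h) - H t]. By the mean value theorem this difference is [h] times a value of [G], hence
    bounded above. *)
Lemma increment_majorant :
  (@lebesgue_measure R).-integrable `[t0, +oo[ (fun t => (deps t)%:E) \/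
  (@lebesgue_measure R).-integrable `[t0, +oo[ (fun t => (deps t ^+ 2 / eps t)%:E) ->
  forall h M : R, 0 < h -> 0 <= M -> exists (K k : R -> R) (B : R),
  [/\ forall t, t0 <= t -> 0 <= k t,
      forall t, t0 <= t -> is_derive t 1 K (k t), forall t, t0 <= t -> K t <= B &
      forall t a, t0 <= t -> 0 <= a -> a <= 2 * M ->
      2 * `|eps (t + h) - eps t| * M * a <= eps (t + h) * a ^+ 2 + k t].
Proof.
move=> int h M h0 M0.
have [G [g [C C0 [g0 G' [B GB] est]]]] := increment_control int h0 M0.
have cG := is_derive_within_continuous G'.
have [H H'] := exists_primitive_within cG.
have tth t : t <= t + h by rewrite lerDl ltW.
exists (fun t => C * (H (t + h) - H t)), (fun t => C * (G (t + h) - G t)), (C * (B * h)).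
split => //.
- move=> t t0t; rewrite mulr_ge0// subr_ge0.
  exact: (is_derive_nondecreasing G').
- move=> t t0t; have H1 := H' _ t0t.
  have H2 := is_derive_translate (H' _ (le_trans t0t (tth t))).
  have H3 := is_deriveB H2 H1.
  exact: is_deriveZ.
- move=> t t0t; apply: ler_wpM2l => //.
  have [|c /andP[tc _] ->] := @is_derive_mvt R H G t (t + h) (tth t).
    by move=> s /andP[ts _]; apply: H'; exact: le_trans ts.
  rewrite addrAC subrr add0r; apply: ler_wpM2r; first exact: ltW.
  by apply: GB; exact: le_trans tc.
Qed.

End IncrementControl.

(** * From increments to velocities; gradient inequality and adjoint bounds *)

Section Velocity.
Set Implicit Arguments. Unset Strict Implicit. Unset Printing Implicit Defensive.
Variable R : realType.

Lemma cvgy0P (g : R -> R) :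
  g @ +oo --> 0 <->
  forall e, 0 < e -> exists T, forall t, T <= t -> `|g t| <= e.
Proof.
split=> [/cvgrPdist_le g0 e e0|H].
  have [T [_ HT]] := g0 e e0; exists (T + 1) => t Tt.
  by have := HT t; rewrite sub0r normrN; apply; apply: lt_le_trans Tt; rewrite ltrDl.
apply/cvgrPdist_le => e e0; have [T HT] := H e e0.
near=> t; rewrite sub0r normrN; apply: HT.
by near: t; apply: nbhs_pinfty_ge; exact: num_real.
Unshelve. all: by end_near. Qed.

(* Over a step h, u moves by h * u'(t) up to h * (L * h + d); hence u'(t) is
   controlled by the increments of u alone. *)
Lemma derivative_vanishes (V : completeNormedModType R) (ip : V -> V -> R)
    (u du : R -> V) (t0 L : R) :
  is_inner_product ip -> 0 <= L ->
  (forall t, t0 <= t -> is_derive t 1 u (du t)) ->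
  (forall d, 0 < d -> exists T, forall t s, T <= t -> t <= s ->
     `|du s - du t| <= L * (s - t) + d) ->
  (forall h, 0 < h -> (fun t => `|u (t + h) - u t|) @ +oo --> 0) ->
  (fun t => `|du t|) @ +oo --> 0.
Proof.
move=> ipP L0 u' slow incr; apply/cvgy0P => e e0.
have e3 : 0 < e / 3 by rewrite divr_gt0.
have L1 : 0 < L + 1 by rewrite ltr_wpDl.
(* Three errors of size [e / 3] are planned: [L * h], the slack [d], and the increment divided by
   [h]. The denominator [L + 1] covers [L = 0]. *)
pose h := e / 3 / (L + 1).
have h0 : 0 < h by rewrite divr_gt0.
have Lh : L * h <= e / 3.
  have : (L + 1) * h = e / 3 by rewrite /h mulrC divfK// gt_eqF.
  by move: h0; nra.
have [T1 HT1] := slow _ e3.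
have [T2 HT2] := (cvgy0P _).1 (incr _ h0) _ (mulr_gt0 h0 e3).
exists (Num.max t0 (Num.max T1 T2)) => t; rewrite !ge_max => /and3P[t0t T1t T2t].
rewrite normr_id; have := HT2 t T2t; rewrite normr_id => incr_le.
have th : t <= t + h by rewrite lerDl ltW.
have := @norm_increment_le R V ip u du (du t) (L * h + e / 3) t (t + h) ipP th.
have {}th : t + h - t = h by rewrite addrAC subrr add0r.
rewrite th => H.
have {}H : `|u (t + h) - u t - h *: du t| <= (L * h + e / 3) * h.
  apply: H => s /andP[ts sh]; first by apply: u'; exact: le_trans ts.
  apply: le_trans (HT1 t s T1t ts) _; rewrite lerD2r ler_wpM2l//; lra.
have : h * `|du t| <= `|u (t + h) - u t| + `|u (t + h) - u t - h *: du t|.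
  rewrite -[X in X * _](ger0_norm (ltW h0)) -normrZ.
  have E : h *: du t = (u (t + h) - u t) - (u (t + h) - u t - h *: du t).
    by rewrite opprB addrC subrK.
  by rewrite {1}E; exact: ler_normB.
move=> H2; rewrite -(ler_pM2l h0); nra.
Qed.

(** Convexity bounds the difference quotient in direction [v - u] by [f v - f u] for steps in []0,
    1]]; the right-hand limit at 0 gives the claim. *)
Lemma gradient_le (X : completeNormedModType R) (ipX : X -> X -> R)
    (f : X -> R) (gradf : X -> X) :
  convex_fun f -> (forall u, differentiable f u) ->
  (forall u h, 'd f u h = ipX (gradf u) h) ->
  forall u v, ipX (gradf u) (v - u) <= f v - f u.
Proof.
move=> fcvx df dfE u v; rewrite -dfE -deriveE//.
have := @diff_derivable _ _ _ f u (v - u) (df u); rewrite /derivable => D.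
have D' : (fun s => s^-1 *: (f (s *: (v - u) + u) - f u)) @ 0^'+ --> 'D_(v - u) f u.
  by apply: cvg_dnbhs_at_right; exact: D.
apply: (cvgr_to_le D').
near=> s.
have s0 : 0 < s by [].
have s1 : s <= 1 by near: s; apply: nbhs_right_le.
rewrite [_ *: _]mulrC ler_pdivrMr//.
have -> : s *: (v - u) + u = s *: v + (1 - s) *: u.
  by rewrite scalerBr scalerBl scale1r addrAC addrA.
have := fcvx v u s; rewrite (ltW s0) s1 => /(_ isT).
lra.
Unshelve. all: by end_near. Qed.

(** The bound for [Astar] comes from testing: with [z] the difference of the two values, the squared
    norm of [z] is [ipY (A z) (v - w)], where the bound on [A] applies. *)
Lemma adjoint_bounded (X Y : completeNormedModType R) ipX ipY
    (A : {linear X -> Y}) (Astar : Y -> X) :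
  @is_inner_product R X ipX -> @is_inner_product R Y ipY ->
  continuous A -> (forall u v, ipY (A u) v = ipX u (Astar v)) ->
  exists2 a, 0 <= a & (forall u, `|A u| <= a * `|u|) /\
    (forall v w, `|Astar v - Astar w| <= a * `|v - w|).
Proof.
move=> hX hY cA adj.
have [a a0 Aa] : exists2 a, 0 < a & forall u, `|A u| <= a * `|u|.
  by have /linear_boundedP/pinfty_ex_gt0 := continuous_linear_bounded 0 (cA 0).
exists a; first exact: ltW.
split => // v w; set z := _ - _.
have [->|z0] := eqVneq z 0; first by rewrite normr0 mulr_ge0// ltW.
have nz : 0 < `|z| by rewrite normr_gt0.
rewrite -(ler_pM2l nz) -expr2 -(ip_norm hX) {2}/z (ipBr hX) -!adj -(ipBr hY).
apply: le_trans (ip_le hY _ _) _.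
by rewrite mulrCA mulrA ler_wpM2r// mulrC.
Qed.

End Velocity.

(** * Energy estimates along the trajectory *)

Section TikhonovFlow.
Set Implicit Arguments. Unset Strict Implicit. Unset Printing Implicit Defensive.
Variables (R : realType) (X Y : completeNormedModType R).
Variables (ipX : X -> X -> R) (ipY : Y -> Y -> R).
Variables (f : X -> R) (gradf : X -> X) (A : {linear X -> Y}) (Astar : Y -> X).
Variables (b : Y) (eps deps : R -> R) (t0 : R).
Variables (x dx : R -> X) (lam dlam : R -> Y).
Hypothesis hX : is_inner_product ipX.
Hypothesis hY : is_inner_product ipY.
Hypothesis grad_le : forall u v, ipX (gradf u) (v - u) <= f v - f u.
Hypothesis adj : forall u v, ipY (A u) v = ipX u (Astar v).
Hypothesis eps_gt0 : forall t, t0 <= t -> 0 < eps t.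
Hypothesis eps' : forall t, t0 <= t -> is_derive t 1 eps (deps t).
Hypothesis cdeps : {within `[t0, +oo[, continuous deps}.
Hypothesis eps_cvg0 : eps @ +oo --> 0.
Hypothesis x' : forall t, t0 <= t -> is_derive t 1 x (dx t).
Hypothesis lam' : forall t, t0 <= t -> is_derive t 1 lam (dlam t).
Hypothesis odex : forall t, t0 <= t ->
  dx t + gradf (x t) + Astar (lam t) + eps t *: x t = 0.
Hypothesis odelam : forall t, t0 <= t -> dlam t + b - A (x t) + eps t *: lam t = 0.
Hypothesis eps_nint :
  ~ (@lebesgue_measure R).-integrable `[t0, +oo[ (fun t => (eps t)%:E).
Hypothesis deps_int :
  (@lebesgue_measure R).-integrable `[t0, +oo[ (fun t => (deps t)%:E) \/
  (@lebesgue_measure R).-integrable `[t0, +oo[ (fun t => (deps t ^+ 2 / eps t)%:E).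
Variables (xb : X) (lb : Y).
Hypothesis saddle : saddle_point (lagrangian ipY f A b) xb lb.

Let gap t := lagrangian ipY f A b (x t) lb - lagrangian ipY f A b xb (lam t).

Lemma ip_dx t w : t0 <= t ->
  ipX (dx t) w = - ipX (gradf (x t)) w - ipY (A w) (lam t) - eps t * ipX (x t) w.
Proof.
move=> /odex/(congr1 (ipX ^~ w)).
rewrite !(ipDl hX) (ipZl hX) (ip0l hX) adj (ip_sym hX w); lra.
Qed.

Lemma ip_dlam t w : t0 <= t ->
  ipY (dlam t) w = ipY (A (x t)) w - ipY b w - eps t * ipY (lam t) w.
Proof.
move=> /odelam/(congr1 (ipY ^~ w)).
by rewrite !(ipDl hY) (ipNl hY) (ipZl hY) (ip0l hY); lra.
Qed.

Lemma gap_ge0 t : 0 <= gap t.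
Proof.
have [h1 h2] := saddle (x t) (lam t); rewrite /gap subr_ge0.
exact: le_trans h1 h2.
Qed.

(** Convexity bounds [f (x t) - f xb] by the gradient term, and the pairing of [A (x t)] with
    [lam t] cancels between the two equations. *)
Lemma gap_le t : t0 <= t ->
  gap t <= - (ipX (dx t + eps t *: x t) (x t - xb)
              + ipY (dlam t + eps t *: lam t) (lam t - lb)).
Proof.
move=> t0t; rewrite (ipDl hX) (ipDl hY) ip_dx// ip_dlam// (ipZl hX) (ipZl hY).
rewrite /gap /lagrangian.
have := grad_le (x t) xb.
rewrite -opprB (ipNr hX) linearB/= !(ipBl hY, ipBr hY) (ip_sym hY lb) (ip_sym hY (lam t)).
rewrite (ip_sym hY lb) (ip_sym hY (lam t)); lra.
Qed.

Lemma trajectory_bounded : exists2 M, 0 <= M &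
  forall t, t0 <= t -> `|x t| <= M /\ `|lam t| <= M.
Proof.
have ceps := is_derive_within_continuous eps'.
have [E E'] := exists_primitive_within ceps.
have eps0 t : t0 <= t -> 0 <= eps t by move=> /eps_gt0/ltW.
pose P t := ipX (x t - xb) (x t - xb) + ipY (lam t - lb) (lam t - lb).
pose N := `|xb| ^+ 2 + `|lb| ^+ 2.
pose dP t := 2 * ipX (dx t) (x t - xb) + 2 * ipY (dlam t) (lam t - lb).
have P' t : t0 <= t -> is_derive t 1 P (dP t).
  move=> t0t; have x't := x' t0t; have l't := lam' t0t.
  apply: is_deriveD; apply: is_derive_ip_self => //.
  - by have := is_deriveB x't (is_derive_cst xb t 1); rewrite subr0.
  - by have := is_deriveB l't (is_derive_cst lb t 1); rewrite subr0.
(* From [2<z, z - zb> = |z - zb|^2 + |z|^2 - |zb|^2], the regularization pulls [P] towards the level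
   [N = |zb|^2]. *)
have dP_le t : t0 <= t -> dP t <= - (eps t * (P t - N)).
  move=> t0t; have := le_trans (gap_ge0 t) (gap_le t0t).
  rewrite (ipDl hX) (ipDl hY) (ipZl hX) (ipZl hY) /dP /P /N -(ip_norm hX) -(ip_norm hY).
  have := mulr_ge0 (eps0 t t0t) (sqr_ge0 `|x t|).
  have := mulr_ge0 (eps0 t t0t) (sqr_ge0 `|lam t|).
  rewrite -(ip_norm hX) -(ip_norm hY).
  rewrite !(ipBl hX, ipBr hX, ipBl hY, ipBr hY) (ip_sym hX xb (x t)) (ip_sym hY lb (lam t)).
  lra.
(* The integrating factor [expR (E t)] turns the preceding inequality into monotonicity. *)
have F' t : t0 <= t -> is_derive t 1 (fun t => expR (E t) * (P t - N))
    (expR (E t) * (dP t + eps t * (P t - N))).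
  move=> t0t.
  have e1 : is_derive t 1 (expR \o E) (expR (E t) * eps t).
    by have := is_derive_expR (E t); have := E' t t0t => *; exact: is_derive1_comp.
  have e2 : is_derive t 1 (fun t => P t - N) (dP t - 0).
    by have := P' t t0t => *; exact: is_deriveB.
  apply: is_derive_eq (is_deriveM e1 e2) _.
  by rewrite /= /GRing.scale/=; ring.
have Fle := is_derive_nonincreasing F' _.
have P_le t : t0 <= t -> P t <= N + `|P t0 - N|.
  move=> t0t; rewrite -lerBlDl.
  have [PN|PN] := leP (P t - N) 0; first exact: le_trans PN (normr_ge0 _).
  apply: le_trans (ler_norm _).
  rewrite -(ler_pM2l (expR_gt0 (E t0))).
  apply: le_trans (_ : expR (E t) * (P t - N) <= _).
    rewrite ler_wpM2r ?(ltW PN)// ler_expR.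
    exact: (is_derive_nondecreasing E' eps0).
  apply: Fle => // s t0s; rewrite pmulr_rle0 ?expR_gt0//.
  by have := dP_le s t0s; lra.
have [xbd lbd] : (forall t, t0 <= t -> `|x t - xb| ^+ 2 <= N + `|P t0 - N|) /\
    (forall t, t0 <= t -> `|lam t - lb| ^+ 2 <= N + `|P t0 - N|).
  split=> t /P_le; apply: le_trans; rewrite /P !(ip_norm hX) !(ip_norm hY).
    by rewrite lerDl sqr_ge0.
  by rewrite lerDr sqr_ge0.
set Q := N + _ in xbd lbd.
(* [Q + 1] serves as a rational substitute for the square root of [Q]. *)
have le_of_sqr (r : R) : 0 <= r -> r ^+ 2 <= Q -> r <= Q + 1 by nra.
have Q0 : 0 <= Q by apply: le_trans (xbd t0 (lexx _)); rewrite sqr_ge0.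
exists (Q + 1 + `|xb| + `|lb|); first by rewrite !addr_ge0.
move=> t t0t; split.
- rewrite -[x t](subrK xb); apply: le_trans (ler_normD _ _) _.
  have := le_of_sqr _ (normr_ge0 _) (xbd t t0t); have := normr_ge0 lb; lra.
- rewrite -[lam t](subrK lb); apply: le_trans (ler_normD _ _) _.
  have := le_of_sqr _ (normr_ge0 _) (lbd t t0t); have := normr_ge0 xb; lra.
Qed.

Lemma gradient_monotone u v : 0 <= ipX (gradf u - gradf v) (u - v).
Proof.
have h1 := grad_le u v; have h2 := grad_le v u.
rewrite -opprB (ipNr hX) in h1; rewrite (ipBl hX); lra.
Qed.

(* Monotonicity of (x, lam) |-> (gradf x + Astar lam, b - A x). *)
Lemma increment_derivative_le t h : t0 <= t -> 0 <= h ->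
  ipX (dx (t + h) - dx t) (x (t + h) - x t) +
  ipY (dlam (t + h) - dlam t) (lam (t + h) - lam t) <=
  - (eps (t + h) * (`|x (t + h) - x t| ^+ 2 + `|lam (t + h) - lam t| ^+ 2))
  + `|eps (t + h) - eps t| *
    (`|x t| * `|x (t + h) - x t| + `|lam t| * `|lam (t + h) - lam t|).
Proof.
move=> t0t h0; have t0s : t0 <= t + h by rewrite (le_trans t0t)// lerDl.
set s := t + h; set u := x s - x t; set v := lam s - lam t.
have mono := gradient_monotone (x s) (x t); rewrite (ipBl hX) -/u in mono.
rewrite (ipBl hX) (ipBl hY) !ip_dx// !ip_dlam//.
(* Expanding [ipY (A u) v] in both arguments exhibits the skew part of the operator: the terms in
   [A] cancel between the two components. *)
have Ev : ipY (A u) v = ipY (A u) (lam s) - ipY (A u) (lam t) by rewrite /v (ipBr hY).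
have Eu : ipY (A u) v = ipY (A (x s)) v - ipY (A (x t)) v by rewrite /u linearB (ipBl hY).
have uu : `|u| ^+ 2 = ipX (x s) u - ipX (x t) u by rewrite -(ip_norm hX) {1}/u (ipBl hX).
have vv : `|v| ^+ 2 = ipY (lam s) v - ipY (lam t) v by rewrite -(ip_norm hY) {1}/v (ipBl hY).
rewrite uu vv.
(* Since [eps s x s - eps t x t = eps s u + (eps s - eps t) x t], damping separates from the
   variation of [eps]; likewise for [lam]. *)
have c1 : - ((eps s - eps t) * ipX (x t) u) <= `|eps s - eps t| * (`|x t| * `|u|).
  rewrite -mulNr; apply: le_trans (ler_norm _) _; rewrite normrM normrN.
  by rewrite ler_wpM2l// ip_cauchy_schwarz.
have c2 : - ((eps s - eps t) * ipY (lam t) v) <= `|eps s - eps t| * (`|lam t| * `|v|).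
  rewrite -mulNr; apply: le_trans (ler_norm _) _; rewrite normrM normrN.
  by rewrite ler_wpM2l// ip_cauchy_schwarz.
move: mono c1 c2 Ev Eu; lra.
Qed.

Lemma increment_vanishes h : 0 < h ->
  (fun t => `|x (t + h) - x t|) @ +oo --> 0 /\
  (fun t => `|lam (t + h) - lam t|) @ +oo --> 0.
Proof.
move=> h0; have [M M0 bnd] := trajectory_bounded.
have t0h t : t0 <= t -> t0 <= t + h by move=> t0t; rewrite (le_trans t0t)// lerDl ltW.
have [K [k [B [k0 K' KB est]]]] := increment_majorant eps_gt0 eps' cdeps deps_int h0 M0.
have ceps := is_derive_within_continuous eps'.
have [E E'] := exists_primitive_within ceps.
have eps0 t : t0 <= t -> 0 <= eps t by move=> /eps_gt0/ltW.
have Eub C : exists2 t, t0 <= t & C < E (t + h).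
  apply: contrapT => nex; apply: eps_nint.
  apply: (integrable_of_bounded_primitive ceps eps0 E' (B := C)) => t t0t.
  rewrite leNgt; apply/negP => CE; apply: nex; exists t => //.
  apply: lt_le_trans CE _; apply: (is_derive_nondecreasing E' eps0) => //.
  by rewrite lerDl ltW.
pose phi t := ipX (x (t + h) - x t) (x (t + h) - x t)
  + ipY (lam (t + h) - lam t) (lam (t + h) - lam t).
pose dphi t := 2 * ipX (dx (t + h) - dx t) (x (t + h) - x t)
  + 2 * ipY (dlam (t + h) - dlam t) (lam (t + h) - lam t).
have phiE t : phi t = `|x (t + h) - x t| ^+ 2 + `|lam (t + h) - lam t| ^+ 2.
  by rewrite /phi (ip_norm hX) (ip_norm hY).
have phi0 : phi @ +oo --> 0.
  (* The derivative of [phi] carries damping [2 * eps (t + h)]; half of it absorbs the cross terms,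
     and each of the two components contributes one [k], whence [2 * k]. *)
  apply: (@cvg_to0_of_derive_le R phi dphi (fun t => 2 * K t) (fun t => 2 * k t)
    (fun t => E (t + h)) (fun t => eps (t + h)) t0 (2 * B)) => //.
  - move=> t t0t; have x't := x' t0t; have l't := lam' t0t.
    have x'h := is_derive_translate (x' (t0h t t0t)).
    have l'h := is_derive_translate (lam' (t0h t t0t)).
    by apply: is_deriveD; apply: is_derive_ip_self => //; exact: is_deriveB.
  - by move=> t t0t; have := K' t t0t => *; exact: is_deriveZ.
  - by move=> t t0t; exact: is_derive_translate (E' _ (t0h t t0t)).
  - by move=> t t0t; rewrite phiE addr_ge0// sqr_ge0.
  - by move=> t t0t; rewrite mulr_ge0// k0.
  - by move=> t t0t; exact/eps0/t0h.
  - move=> t t0t; have := increment_derivative_le t0t (ltW h0).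
    have [xM lM] := bnd t t0t; have [xhM lhM] := bnd _ (t0h t t0t).
    have ux : `|x (t + h) - x t| <= 2 * M.
      by apply: le_trans (ler_normB _ _) _; lra.
    have ul : `|lam (t + h) - lam t| <= 2 * M.
      by apply: le_trans (ler_normB _ _) _; lra.
    have e1 := est t _ t0t (normr_ge0 _) ux.
    have e2 := est t _ t0t (normr_ge0 _) ul.
    rewrite /dphi phiE.
    have de := normr_ge0 (eps (t + h) - eps t).
    have m1 : `|eps (t + h) - eps t| * (`|x t| * `|x (t + h) - x t|)
        <= `|eps (t + h) - eps t| * (M * `|x (t + h) - x t|).
      by rewrite ler_wpM2l// ler_wpM2r.
    have m2 : `|eps (t + h) - eps t| * (`|lam t| * `|lam (t + h) - lam t|)
        <= `|eps (t + h) - eps t| * (M * `|lam (t + h) - lam t|).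
      by rewrite ler_wpM2l// ler_wpM2r.
    move: e1 e2 m1 m2; lra.
  - by move=> t t0t; rewrite ler_wpM2l// KB.
have sqrt_cvg (g : R -> R) : (forall t, 0 <= g t) -> (forall t, g t ^+ 2 <= phi t) -> g @ +oo --> 0.
  move=> g0 gphi; apply/cvgy0P => e e0.
  have [T HT] := (cvgy0P _).1 phi0 _ (exprn_gt0 2 e0).
  exists T => t Tt; rewrite ger0_norm// -ler_sqr ?nnegrE ?g0 ?(ltW e0)//.
  exact: le_trans (gphi t) (le_trans (ler_norm _) (HT t Tt)).
by split; apply: sqrt_cvg => t //; rewrite phiE ?lerDl ?lerDr sqr_ge0.
Qed.

(** Each equation is subtracted at two times and tested against the velocity difference [w] itself,
    so a bound of [ip w w] by [c * |w|] yields [|w| <= c]. The [eps] terms are bounded crudely by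
    [M], because [eps] tends to 0. *)
Lemma derivative_variation_le L M t s :
  0 <= L ->
  (forall u, `|A u| <= L * `|u|) ->
  (forall v w, `|Astar v - Astar w| <= L * `|v - w|) ->
  (forall u v, `|u| <= M -> `|v| <= M -> `|gradf u - gradf v| <= L * `|u - v|) ->
  (forall r, t0 <= r -> `|x r| <= M /\ `|lam r| <= M) ->
  t0 <= t -> t0 <= s ->
  `|dx s - dx t| <= L * (`|x s - x t| + `|lam s - lam t|) + (eps s + eps t) * M /\
  `|dlam s - dlam t| <= L * (`|x s - x t| + `|lam s - lam t|) + (eps s + eps t) * M.
Proof.
move=> L0 AL AsL gL bnd t0t t0s.
have [xt lt] := bnd t t0t; have [xs ls] := bnd s t0s.
have dual (V : completeNormedModType R) (ip : V -> V -> R) (w : V) (c : R) :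
    is_inner_product ip -> 0 <= c -> ip w w <= c * `|w| -> `|w| <= c.
  move=> ipP c0; rewrite (ip_norm ipP).
  have [->|w0] := eqVneq w 0; first by rewrite normr0.
  by rewrite expr2 ler_pM2r ?normr_gt0.
have et := eps_gt0 t0t; have es := eps_gt0 t0s.
have M0 : 0 <= M := le_trans (normr_ge0 _) xt.
have c0 : 0 <= L * (`|x s - x t| + `|lam s - lam t|) + (eps s + eps t) * M.
  by rewrite addr_ge0// mulr_ge0// addr_ge0// ltW.
have tik (V : completeNormedModType R) (ip : V -> V -> R) (p q w : V) :
    is_inner_product ip -> `|p| <= M -> `|q| <= M ->
    eps t * ip q w - eps s * ip p w <= (eps s + eps t) * M * `|w|.
  move=> ipP pM qM.
  have h1 : ip q w <= M * `|w|.
    by apply: le_trans (ip_le ipP _ _) _; rewrite ler_wpM2r.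
  have h2 : - ip p w <= M * `|w|.
    by rewrite -(ipNl ipP); apply: le_trans (ip_le ipP _ _) _; rewrite normrN ler_wpM2r.
  have := ler_wpM2l (ltW et) h1; have := ler_wpM2l (ltW es) h2; lra.
split.
- set w := dx s - dx t; apply: (dual _ _ _ _ hX c0).
  rewrite {1}/w (ipBl hX) !ip_dx// !adj.
  have h1 : - (ipX (gradf (x s) - gradf (x t)) w) <= L * `|x s - x t| * `|w|.
    rewrite -(ipNl hX); apply: le_trans (ip_le hX _ _) _.
    by rewrite normrN ler_wpM2r// gL.
  have h2 : - (ipX w (Astar (lam s) - Astar (lam t))) <= L * `|lam s - lam t| * `|w|.
    rewrite (ip_sym hX) -(ipNl hX); apply: le_trans (ip_le hX _ _) _.
    by rewrite normrN ler_wpM2r.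
  have h3 := tik _ _ (x s) (x t) w hX xs xt.
  rewrite (ipBl hX) in h1; rewrite (ipBr hX) in h2; lra.
- set w := dlam s - dlam t; apply: (dual _ _ _ _ hY c0).
  rewrite {1}/w (ipBl hY) !ip_dlam//.
  have h1 : ipY (A (x s) - A (x t)) w <= L * `|x s - x t| * `|w|.
    by apply: le_trans (ip_le hY _ _) _; rewrite -linearB ler_wpM2r.
  have h2 : 0 <= L * `|lam s - lam t| * `|w| by rewrite !mulr_ge0.
  have h3 := tik _ _ (lam s) (lam t) w hY ls lt.
  rewrite (ipBl hY) in h1; lra.
Qed.

(** Bounded velocity makes the trajectory Lipschitz; [derivative_variation_le] then shows that the
    velocity varies slowly, as [derivative_vanishes] requires. *)
Lemma velocity_vanishes L M :
  0 <= L ->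
  (forall u, `|A u| <= L * `|u|) ->
  (forall v w, `|Astar v - Astar w| <= L * `|v - w|) ->
  (forall u v, `|u| <= M -> `|v| <= M -> `|gradf u - gradf v| <= L * `|u - v|) ->
  (forall r, t0 <= r -> `|x r| <= M /\ `|lam r| <= M) ->
  (fun t => `|dx t|) @ +oo --> 0 /\ (fun t => `|dlam t|) @ +oo --> 0.
Proof.
move=> L0 AL AsL gL bnd.
have M0 : 0 <= M := le_trans (normr_ge0 _) (bnd t0 (lexx _)).1.
have [T1 HT1] := (cvgy0P _).1 eps_cvg0 _ ltr01.
have epsle e t : t0 <= t -> `|eps t| <= e -> 0 < eps t <= e.
  by move=> t0t; have e0 := eps_gt0 t0t; rewrite gtr0_norm// e0.
pose T := Num.max t0 T1.
(* Comparison with time [T]: the two state increments total at most [4 * M], and both values of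
   [eps] are at most 1. *)
pose D := `|dx T| + `|dlam T| + L * (4 * M) + 2 * M.
have var := derivative_variation_le L0 AL AsL gL bnd.
have t0T : t0 <= T by rewrite le_max lexx.
have epsT t : T <= t -> 0 < eps t <= 1.
  by rewrite ge_max => /andP[t0t T1t]; apply: epsle => //; exact: HT1.
have speed t : T <= t -> `|dx t| <= D /\ `|dlam t| <= D.
  move=> Tt; have t0t := le_trans t0T Tt.
  have [v1 v2] := var T t t0T t0t.
  have [xt lt] := bnd t t0t; have [xT lT] := bnd T t0T.
  have /andP[e1 e2] := epsT t Tt; have /andP[e3 e4] := epsT T (lexx _).
  have c : L * (`|x t - x T| + `|lam t - lam T|) + (eps t + eps T) * M
      <= L * (4 * M) + 2 * M.
    rewrite lerD ?ler_wpM2l ?ler_wpM2r//; last lra.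
    have := ler_normB (x t) (x T); have := ler_normB (lam t) (lam T); lra.
  split; rewrite /D.
    rewrite -[dx t](subrK (dx T)); apply: le_trans (ler_normD _ _) _.
    by have := normr_ge0 (dlam T); lra.
  rewrite -[dlam t](subrK (dlam T)); apply: le_trans (ler_normD _ _) _.
  by have := normr_ge0 (dx T); lra.
have D0 : 0 <= D by exact: le_trans (normr_ge0 _) (speed T (lexx _)).1.
have LD : 0 <= L * (2 * D) by rewrite !mulr_ge0.
have slow d : 0 < d -> exists S, forall t s, S <= t -> t <= s ->
    `|dx s - dx t| <= L * (2 * D) * (s - t) + d /\
    `|dlam s - dlam t| <= L * (2 * D) * (s - t) + d.
  move=> d0.
  have M1 : 0 < 2 * M + 1 by lra.
  (* With [eps] below [d / (2 * M + 1)], the sum [(eps s + eps t) * M] is at most [d]; the added 1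
     covers [M = 0]. *)
  have [T2 HT2] := (cvgy0P _).1 eps_cvg0 _ (divr_gt0 d0 M1).
  exists (Num.max T T2) => t s; rewrite ge_max => /andP[Tt T2t] ts.
  have t0t := le_trans t0T Tt; have t0s := le_trans t0t ts.
  have [v1 v2] := var t s t0t t0s.
  have xst : `|x s - x t| <= D * (s - t).
    have := @norm_increment_le R X ipX x dx 0 D t s hX ts.
    rewrite scaler0 subr0; apply=> r /andP[tr _]; first exact/x'/(le_trans t0t).
    by rewrite subr0; exact: (speed r (le_trans Tt tr)).1.
  have lst : `|lam s - lam t| <= D * (s - t).
    have := @norm_increment_le R Y ipY lam dlam 0 D t s hY ts.
    rewrite scaler0 subr0; apply=> r /andP[tr _]; first exact/lam'/(le_trans t0t).
    by rewrite subr0; exact: (speed r (le_trans Tt tr)).2.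
  have /andP[e1 e2] := epsle _ t t0t (HT2 t T2t).
  have /andP[e3 e4] := epsle _ s t0s (HT2 s (le_trans T2t ts)).
  have eM : (eps s + eps t) * M <= d.
    have : (eps s + eps t) * M <= (2 * (d / (2 * M + 1))) * M.
      by rewrite ler_wpM2r//; lra.
    move=> /le_trans; apply.
    have : d / (2 * M + 1) * (2 * M + 1) = d by rewrite divfK// gt_eqF.
    have := divr_gt0 d0 M1; lra.
  have c : L * (`|x s - x t| + `|lam s - lam t|) <= L * (2 * D) * (s - t).
    by rewrite -mulrA ler_wpM2l//; lra.
  by split; [move: v1 | move: v2]; lra.
split.
- apply: (derivative_vanishes hX LD x').
    by move=> d /slow[S HS]; exists S => t s St ts; exact: (HS t s St ts).1.
  by move=> h /increment_vanishes[].
- apply: (derivative_vanishes hY LD lam').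
    by move=> d /slow[S HS]; exists S => t s St ts; exact: (HS t s St ts).2.
  by move=> h /increment_vanishes[].
Qed.

(** By [gap_le] and Cauchy-Schwarz, the nonnegative gap is at most a sum of products of a vanishing
    factor and a bounded one. *)
Lemma gap_vanishes M :
  (forall r, t0 <= r -> `|x r| <= M /\ `|lam r| <= M) ->
  (fun t => `|dx t|) @ +oo --> 0 -> (fun t => `|dlam t|) @ +oo --> 0 ->
  (fun t => lagrangian ipY f A b (x t) lb - lagrangian ipY f A b xb (lam t))
    @ +oo --> 0.
Proof.
move=> bnd dx0 dlam0.
pose up t := (`|dx t| + eps t * M) * (M + `|xb|) + (`|dlam t| + eps t * M) * (M + `|lb|).
have up0 : up @ +oo --> 0.
  have -> : 0 = (0 + 0 * M) * (M + `|xb|) + (0 + 0 * M) * (M + `|lb|) :> R by ring.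
  by apply: cvgD; apply: cvgMl; apply: cvgD => //; apply: cvgMl.
apply: (@squeeze_cvgr _ _ _ _ (cst 0) up) => //; last exact: cvg_cst.
near=> t.
have t0t : t0 <= t by near: t; apply: nbhs_pinfty_ge; exact: num_real.
rewrite -/(gap t) gap_ge0/=; apply: le_trans (gap_le t0t) _.
have [xM lM] := bnd t t0t; have e0 := ltW (eps_gt0 t0t).
have est (V : completeNormedModType R) (ip : V -> V -> R) (u v w : V) :
    is_inner_product ip -> `|v| <= M ->
    - ip (u + eps t *: v) (v - w) <= (`|u| + eps t * M) * (M + `|w|).
  move=> ipP vM; rewrite -(ipNl ipP); apply: le_trans (ip_le ipP _ _) _.
  rewrite normrN; apply: ler_pM => //.
    apply: le_trans (ler_normD _ _) _.
    by rewrite lerD2l normrZ ger0_norm// ler_wpM2l.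
  by apply: le_trans (ler_normB _ _) _; rewrite lerD2r.
by rewrite opprD lerD// est.
Unshelve. all: by end_near. Qed.

End TikhonovFlow.

(** * Assembly of the estimates into convergence of gap and velocity *)

Theorem theorem3p4 (R : realType)
  (X Y : completeNormedModType R) (ipX : X -> X -> R) (ipY : Y -> Y -> R)
  (f : X -> R) (gradf : X -> X) (A : {linear X -> Y}) (Astar : Y -> X) (b : Y)
  (eps : R -> R) (t0 : R) (x : R -> X) (lam : R -> Y) :
  (* X, Y real Hilbert spaces *)
  is_inner_product ipX -> is_inner_product ipY ->
  (* f convex, continuously (Frechet) differentiable with gradient gradf,
     gradf Lipschitz continuous on bounded sets *)
  convex_fun f ->
  (forall u : X, differentiable f u) ->
  (forall u h : X, 'd f u h = ipX (gradf u) h) ->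
  continuous gradf ->
  lipschitz_on_bounded gradf ->
  (* A linear continuous, with adjoint Astar *)
  continuous A ->
  (forall (u : X) (v : Y), ipY (A u) v = ipX u (Astar v)) ->
  (* eps : [t0,+oo[ -> ]0,+oo[, C^1, eps t -> 0 *)
  0 <= t0 ->
  (forall t, t0 <= t -> 0 < eps t) ->
  (forall t, t0 <= t -> derivable eps t 1) ->
  {within `[t0, +oo[, continuous derive1 eps} ->
  eps @ +oo --> 0 ->
  (* S x M nonempty *)
  (exists (xb : X) (lb : Y), saddle_point (lagrangian ipY f A b) xb lb) ->
  (* (x, lam) is a C^1 solution of (AHT) on [t0,+oo[ *)
  (forall t, t0 <= t -> derivable x t 1) ->
  (forall t, t0 <= t -> derivable lam t 1) ->
  {within `[t0, +oo[, continuous derive1 x} ->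
  {within `[t0, +oo[, continuous derive1 lam} ->
  (forall t, t0 <= t ->
     derive1 x t + gradf (x t) + Astar (lam t) + eps t *: x t = 0) ->
  (forall t, t0 <= t ->
     derive1 lam t + b - A (x t) + eps t *: lam t = 0) ->
  (* eps not in L^1([t0,+oo[) *)
  ~ (@lebesgue_measure R).-integrable `[t0, +oo[ (fun t => (eps t)%:E) ->
  (* eps' in L^1 or |eps'|^2/eps in L^1 *)
  ((@lebesgue_measure R).-integrable `[t0, +oo[ (fun t => (derive1 eps t)%:E) \/
   (@lebesgue_measure R).-integrable `[t0, +oo[
      (fun t => ((derive1 eps t) ^+ 2 / eps t)%:E)) ->
  forall (xb : X) (lb : Y), saddle_point (lagrangian ipY f A b) xb lb ->
    (fun t => lagrangian ipY f A b (x t) lb - lagrangian ipY f A b xb (lam t))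
      @ +oo --> 0
    /\ (fun t => prod_norm (derive1 x t) (derive1 lam t)) @ +oo --> 0.
Proof.
move=> hX hY fcvx fdiff fgrad _ glip cA adj _ eps_gt0 deps cdeps eps0 _ dx dlam _ _ odex odelam
  nint dint xb lb saddle.
have D (V : normedModType R) (u : R -> V) : (forall t, t0 <= t -> derivable u t 1) ->
    forall t, t0 <= t -> is_derive t 1 u (derive1 u t).
  by move=> du t t0t; rewrite derive1E; exact/derivableP/du.
have grad_le := gradient_le fcvx fdiff fgrad.
have eps' := D _ _ deps; have x' := D _ _ dx; have lam' := D _ _ dlam.
have [M M0 bnd] := trajectory_bounded hX hY grad_le adj eps_gt0 eps' x' lam' odex odelam saddle.
have [a a0 [Aa Asa]] := adjoint_bounded hX hY cA adj.
have [K gK] := glip M.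
(* One constant serves [A], [Astar] and [gradf]; the absolute value is taken because [K] may be
   negative. *)
pose L := a + `|K|.
have [v1 v2] : (fun t => `|derive1 x t|) @ +oo --> 0 /\ (fun t => `|derive1 lam t|) @ +oo --> 0.
  apply: (velocity_vanishes hX hY grad_le adj eps_gt0 eps' cdeps eps0 x' lam' odex odelam
    nint dint saddle (L := L) (M := M)) => //.
  - by rewrite addr_ge0.
  - by move=> u; apply: le_trans (Aa u) _; rewrite ler_wpM2r// lerDl.
  - by move=> u v; apply: le_trans (Asa u v) _; rewrite ler_wpM2r// lerDl.
  - move=> u v uM vM; apply: le_trans (gK u v uM vM) _; rewrite ler_wpM2r//.
    by apply: le_trans (ler_norm K) _; rewrite lerDr.
split; first exact: (gap_vanishes hX hY grad_le adj eps_gt0 eps0 odex odelam saddle bnd v1 v2).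
have : (fun t => Num.sqrt (`|derive1 x t| ^+ 2 + `|derive1 lam t| ^+ 2)) @ +oo
    --> Num.sqrt (0 ^+ 2 + 0 ^+ 2 : R).
  apply: (continuous_cvg _ (@sqrt_continuous R _)).
  by apply: cvgD; rewrite expr2; apply: cvgM.
by rewrite expr0n/= addr0 sqrtr0.
Qed.
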